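(* Let $k\ge5$, let $\mathbf{S}\in\mathbb{C}^{k\times k}$ be a generic skew-symmetric constant matrix, let $\tau$ be a non-constant monomial in $\mathbf{t}$, and set $$\mathbf{L}_0:=(\mathbb{1}_k\mid\mathbb{1}_k)\in\mathbb{C}^{k\times 2k},\qquad \mathbf{r}_0(\tau):=\tau\cdot\mathbf{1}_k\cdot\mathbf{1}_k^{\mathtt{T}}+\mathbf{S},\qquad \mathbf{R}_0(\tau):=(\mathbb{1}_k\mid\mathbf{r}_0(\tau))^{\mathtt{T}},$$ where $\mathbb{1}_k$ is the identity matrix and $\mathbf{1}_k$ is the all-ones column vector. Then for all $\mathcal{I}\in\mathfrak{G}(\mathbf{L}_0)$: $$\Delta_{\mathbf{R}_0(\tau)}(\mathcal{I})\text{ is constant}\iff \big|[k]\setminus\mathcal{I}\big|\text{ is even}.$$ Moreover, this configuration, whose observable terms arise from the principal minors of $\mathbf{r}_0(\tau)$ (i.e. for $\mathcal{I}\in\mathfrak{G}(\mathbf{L}_0)$ the minor $\Delta_{\mathbf{R}_0(\tau)}(\mathcal{I})$ is, up to sign, the principal minor of $\mathbf{r}_0(\tau)$ indexed by $[k]\setminus\mathcal{I}$), is not separable: some basis in $\mathfrak{G}(\mathbf{L}_0)$ is not separable.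
   Context: Notation. $n=2k$, $[n]=\{1,\dots,n\}$, $\wp_k[n]$ is the set of $k$-element subsets of $[n]$, $\mathbf{t}=(t_1,\dots,t_d)$ are indeterminates; a monomial in $\mathbf{t}$ is $c\,\mathbf{t}^{\mathbf{e}}=c\prod_u t_u^{e_u}$ with $c\in\mathbb{C}\setminus\{0\}$, $\mathbf{e}\in\mathbb{Z}^d$; ''constant'' means independent of $\mathbf{t}$. For a $k\times n$ (resp. $n\times k$) matrix $\mathbf{M}$, $\Delta_{\mathbf{M}}(\mathcal{I})$ is the maximal minor on the columns (resp. rows) indexed by $\mathcal{I}\in\wp_k[n]$ in increasing order, and $\mathfrak{G}(\mathbf{M})=\{\mathcal{I}:\Delta_{\mathbf{M}}(\mathcal{I})\ne0\}$; elements of $\mathfrak{G}(\mathbf{L}_0)$ are called bases. ''Generic'' means: for $\mathbf{S}$ in a non-empty Zariski-open subset of the space of skew-symmetric $k\times k$ complex matrices. Separability. Put $h(\mathcal{I})=\Delta_{\mathbf{L}_0}(\mathcal{I})\Delta_{\mathbf{R}_0(\tau)}(\mathcal{I})$, $\mathcal{I}^{\mathtt{C}}=[n]\setminus\mathcal{I}$, and $\mathcal{I}^{i_1i_2\dots}_{\alpha_1\alpha_2\dots}=(\mathcal{I}\setminus\{i_1,i_2,\dots\})\cup\{\alpha_1,\alpha_2,\dots\}$. For a basis $\mathcal{I}$, distinct $i,j\in\mathcal{I}$ and distinct $\alpha,\beta\in\mathcal{I}^{\mathtt{C}}$, let $\chi(\mathcal{I}|^{ij}_{\alpha\beta})=\{h(\mathcal{I})h(\mathcal{I}^{ij}_{\alpha\beta}),\,h(\mathcal{I}^i_\alpha)h(\mathcal{I}^j_\beta),\,h(\mathcal{I}^i_\beta)h(\mathcal{I}^j_\alpha)\}$.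 It is observable if it is $\ne\{0\}$; an observable set is separable if all its non-zero elements are monomials with the same exponent $\mathbf{e}$; a basis $\mathcal{I}$ is separable if all observable sets $\chi(\mathcal{I}|^{ij}_{\alpha\beta})$ are separable. *)

(* Defs.v *)
From HB Require Import structures.
From mathcomp Require Import all_boot all_order all_algebra.
From mathcomp Require Import fraction finmap.
From mathcomp Require Import mpoly.
From mathcomp Require Import complex reals.

Set Implicit Arguments.
Unset Strict Implicit.
Unset Printing Implicit Defensive.

Import GRing.Theory.
Local Open Scope ring_scope.

(* Laurent monomials and their polynomials are taken in the field C(t_1,...,t_d)
   of rational functions, which contains C[t_1^{+-1},...,t_d^{+-1}]. *)
Notation ratfun C d := {fraction {mpoly C[d]}}.

Definition ratC (C : fieldType) (d : nat) (c : C) : ratfun C d :=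
  tofrac (c%:MP_[d]).

Definition ratX (C : fieldType) (d : nat) (u : 'I_d) : ratfun C d :=
  tofrac ('X_u : {mpoly C[d]}).

Definition is_constant (C : fieldType) (d : nat) (x : ratfun C d) : Prop :=
  exists c : C, x = ratC d c.

Definition monomial_with_exponent (C : fieldType) (d : nat) (e : 'I_d -> int)
    (x : ratfun C d) : Prop :=
  exists2 c : C, c != 0 & x = ratC d c * \prod_(u < d) ratX C u ^ e u.

Definition is_monomial (C : fieldType) (d : nat) (x : ratfun C d) : Prop :=
  exists e : 'I_d -> int, monomial_with_exponent e x.

(* [enum_val] lists the elements of a set of ordinals in increasing order.
   Both minors get the junk value 0 on sets that do not have k elements. *)
Definition col_minor (A : comNzRingType) (k n : nat) (M : 'M[A]_(k, n))
    (I : {set 'I_n}) : A :=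
  match #|I| =P k with
  | ReflectT e => \det (colsub (fun j => enum_val (cast_ord (esym e) j)) M)
  | ReflectF _ => 0
  end.

Definition row_minor (A : comNzRingType) (k n : nat) (M : 'M[A]_(n, k))
    (I : {set 'I_n}) : A :=
  match #|I| =P k with
  | ReflectT e => \det (rowsub (fun j => enum_val (cast_ord (esym e) j)) M)
  | ReflectF _ => 0
  end.

Definition principal_minor (A : comNzRingType) (k : nat) (M : 'M[A]_k)
    (J : {set 'I_k}) : A :=
  \det (mxsub (fun i : 'I_#|J| => enum_val i) (fun j : 'I_#|J| => enum_val j) M).

Definition bases (A : comNzRingType) (k n : nat) (M : 'M[A]_(k, n)) :
    {set {set 'I_n}} :=
  [set I : {set 'I_n} | (#|I| == k) && (col_minor M I != 0)].

Definition exch1 (n : nat) (I : {set 'I_n}) (i a : 'I_n) : {set 'I_n} :=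
  (I :\ i) :|: [set a].

Definition exch2 (n : nat) (I : {set 'I_n}) (i j a b : 'I_n) : {set 'I_n} :=
  (I :\: [set i; j]) :|: [set a; b].

Definition chi (F : comNzRingType) (n : nat) (h : {set 'I_n} -> F)
    (I : {set 'I_n}) (i j a b : 'I_n) : {fset F} :=
  [fset h I * h (exch2 I i j a b);
        h (exch1 I i a) * h (exch1 I j b);
        h (exch1 I i b) * h (exch1 I j a)]%fset.

Definition observable (F : comNzRingType) (X : {fset F}) : Prop :=
  X != [fset 0]%fset.

Definition separable_set (C : fieldType) (d : nat) (X : {fset ratfun C d}) :
    Prop :=
  exists e : 'I_d -> int,
    forall x, x \in X -> x != 0 -> monomial_with_exponent e x.

Definition hterm (C : fieldType) (d k n : nat) (L : 'M[C]_(k, n))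
    (R : 'M[ratfun C d]_(n, k)) (I : {set 'I_n}) : ratfun C d :=
  ratC d (col_minor L I) * row_minor R I.

Definition separable_basis (C : fieldType) (d k n : nat) (L : 'M[C]_(k, n))
    (R : 'M[ratfun C d]_(n, k)) (I : {set 'I_n}) : Prop :=
  forall i j a b : 'I_n, i \in I -> j \in I -> i != j ->
    a \in ~: I -> b \in ~: I -> a != b ->
    observable (chi (hterm L R) I i j a b) ->
    separable_set (chi (hterm L R) I i j a b).

Definition skew_symmetric (C : fieldType) (k : nat) (S : 'M[C]_k) : Prop :=
  S^T = - S.

(* The Zariski topology of the linear space of skew-symmetric matrices is
   induced by that of the space of all matrices, so an open set is the set of
   skew-symmetric S at which some member of a family P of polynomials in the k^2
   entries does not vanish. *)
Definition zariski_open_skew (C : fieldType) (k : nat) (U : 'M[C]_k -> Prop) :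
    Prop :=
  exists P : {mpoly C[k * k]} -> Prop,
    forall S : 'M[C]_k,
      U S <-> skew_symmetric S /\
              exists2 p, P p & p.@[fun i => mxvec S 0 i] != 0.

Definition for_generic_skew (C : fieldType) (k : nat) (Q : 'M[C]_k -> Prop) :
    Prop :=
  exists U : 'M[C]_k -> Prop,
    [/\ zariski_open_skew U, exists S, U S & forall S, U S -> Q S].

Definition L0 (A : comNzRingType) (k : nat) : 'M[A]_(k, k + k) :=
  row_mx 1%:M 1%:M.

Definition r0 (A : comNzRingType) (k : nat) (tau : A) (S : 'M[A]_k) : 'M[A]_k :=
  tau *: ((const_mx 1 : 'cV_k) *m (const_mx 1 : 'cV_k)^T) + S.

Definition R0 (A : comNzRingType) (k : nat) (tau : A) (S : 'M[A]_k) :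
    'M[A]_(k + k, k) :=
  (row_mx 1%:M (r0 tau S))^T.

Definition const_matrix (C : fieldType) (d k : nat) (S : 'M[C]_k) :
    'M[ratfun C d]_k :=
  map_mx (@ratC C d) S.

(* [k] \ I, where [k] sits in [2k] = 'I_(k + k) through [lshift]. *)
Definition missing (k : nat) (I : {set 'I_(k + k)}) : {set 'I_k} :=
  [set i : 'I_k | lshift k i \notin I].

(* Main.v *)
Require Import Defs.
From HB Require Import structures.
From mathcomp Require Import all_boot all_order all_algebra.
From mathcomp Require Import fraction finmap.
From mathcomp Require Import mpoly.
From mathcomp Require Import complex reals.
From mathcomp Require Import perm.

Set Implicit Arguments.
Unset Strict Implicit.
Unset Printing Implicit Defensive.

Import GRing.Theory Num.Theory.
Local Open Scope ring_scope.

(** The minors of R_0(tau) at bases are principal minors of r_0(tau), because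
    the bases of (1 | 1) are the transversals of the pairs {i, k + i}. If I
    takes k + i for i in J and i otherwise, then the corresponding columns of
    (1 | M) form, once reordered, a matrix that has unit columns outside J, and
    its determinant is the principal minor of M at J
    ([col_minor_transversal], [bases_L0]).

    Such a minor is det (S_J + tau U), with U the all-ones matrix. Since U has
    rank one, this is an affine function of tau ([det_rank_one_affine]). Since
    S_J is skew-symmetric and U symmetric, transposition turns tau into - tau
    up to the factor (-1)^|J|, so the affine function is even or odd together
    with |J|. Hence it is det (S_J + U) when |J| is even, and
    tau det (S_J + U) when |J| is odd ([det_skew_all_ones]).

    The genericity condition is that no det (S_J + U) vanishes. It holds for
    the matrix with 1 above and -1 below the diagonal, as S_J + U is then upper
    unitriangular ([sign_matrix_minor]). Under it the minor at J is a non-zero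
    constant times tau^(|J| mod 2), which gives the parity criterion.

    For J empty and p distinct from q, the exchange of p and q makes
    h(I) h(I^pq) a non-zero constant and h(I^p) h(I^q) a non-zero multiple of
    tau^2. If the basis [k] were separable, tau^2 would be constant, and so
    would tau, because constants have square roots
    ([transversal0_not_separable]). *)

(** * Skew-symmetric matrices plus a multiple of the all-ones matrix *)

Section RankOne.

Variables (A : comNzRingType) (m : nat).

(** The scalar t now occurs in a single row, so multilinearity of the
    determinant applies to it. *)
Lemma det_rank_one_block (M : 'M[A]_m) (u : 'cV[A]_m) (v : 'rV[A]_m) t :
  \det (M + t *: (u *m v)) =
    \det (block_mx 1%:M (- (t *: v)) u M : 'M_(1 + m)).
Proof.
set B : 'M_(1 + m) := block_mx _ _ _ _.
have: B *m (block_mx 1%:M (t *: v) 0 1%:M : 'M_(1 + m)) =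
      block_mx 1%:M 0 u (M + t *: (u *m v)).
  rewrite mulmx_block !mul1mx !mulmx1 !mulmx0 !addr0 subrr.
  by rewrite -scalemxAr addrC.
move/(congr1 determinant); rewrite det_mulmx det_ublock det_lblock !det1.
by rewrite !mulr1 mul1r => ->.
Qed.

Lemma det_rank_one_affine (M : 'M[A]_m) (u : 'cV[A]_m) (v : 'rV[A]_m) t :
  \det (M + t *: (u *m v)) =
    t * \det (M + u *m v) + (1 - t) * \det M.
Proof.
(* Row 0 of the bordered matrix for t is t times that for 1 plus 1 - t times
   that for 0. *)
have E1 := det_rank_one_block M u v 1; rewrite !scale1r in E1.
have E0 := det_rank_one_block M u v 0; rewrite !scale0r addr0 in E0.
rewrite E1 E0 det_rank_one_block.
apply: (@determinant_multilinear _ _ _ _ _ (lshift m ord0)).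
- rewrite /block_mx !rowKu !row_row_mx !scale_row_mx add_row_mx.
  congr row_mx; first by rewrite -scalerDl subrKC scale1r.
  by apply/rowP=> j; rewrite !mxE oppr0 mulr0 addr0 mulrN.
- by apply/matrixP=> i j; rewrite !mxE; case: splitP => // l; rewrite (ord1 l).
- by apply/matrixP=> i j; rewrite !mxE; case: splitP => // l; rewrite (ord1 l).
Qed.

End RankOne.

(** Transposition makes the affine function t |-> det (S + t U) even or odd
    according to the parity of m; comparing its values at 1 and -1, respectively
    at 0, leaves one coefficient, provided that 2 is invertible. *)
Lemma det_skew_all_ones (F : idomainType) m (S : 'M[F]_m) t :
    (2%:R : F) != 0 -> S^T = - S ->
  \det (S + t *: const_mx 1) = \det (S + const_mx 1) * t ^+ odd m.
Proof.
move=> two_neq0 skewS.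
have ones: const_mx 1 = (const_mx 1 : 'cV[F]_m) *m (const_mx 1 : 'rV[F]_m).
  by apply/matrixP=> i j; rewrite !mxE big_ord1 !mxE mulr1.
have affine s : \det (S + s *: const_mx 1) =
    s * \det (S + const_mx 1) + (1 - s) * \det S.
  by rewrite ones det_rank_one_affine.
have flip s : \det (S + (- s) *: const_mx 1) =
    (-1) ^+ m * \det (S + s *: const_mx 1).
  rewrite -detZ scaleN1r opprD -skewS -[in RHS]det_tr linearD /= trmxK.
  by congr (\det (_ + _)); apply/matrixP=> i j; rewrite !mxE mulNr.
have := flip 1; have := flip 0; rewrite !affine -signr_odd.
rewrite !oppr0 !mul0r !add0r !addr0 !mul1r subrr mul0r addr0 opprK.
case: (odd m) => /=.
  rewrite expr1 !mulN1r => /eqP; rewrite -addr_eq0 -mulr2n -mulr_natl.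
  by rewrite mulf_eq0 (negPf two_neq0) /= => /eqP-> _; rewrite mulr0 addr0 mulrC.
rewrite expr0 mulN1r !mul1r => _ /eqP.
rewrite addrC subr_eq -!mulr2n -[X in _ == X]mulr_natl -subr_eq0 -mulrBr.
rewrite mulf_eq0 (negPf two_neq0) /= subr_eq0 => /eqP->.
by rewrite -mulrDl addrC subrK mul1r mulr1.
Qed.

(** * Maximal minors of (1 | M) at transversals *)

(** The sizes m and k are equal only propositionally, which is what happens when
    the indices are split into a set and its complement. *)
Lemma det_mxsub_bij (A : comNzRingType) k m (f : 'I_m -> 'I_k) (M : 'M[A]_k) :
  bijective f -> \det (mxsub f f M) = \det M.
Proof.
move=> bij_f; have := bij_eq_card bij_f; rewrite !card_ord => eq_mk.
case: _ / eq_mk M f bij_f => M f bij_f.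
pose s := perm (bij_inj bij_f).
have -> : mxsub f f M = row_perm s (col_perm s M).
  by apply/matrixP=> i j; rewrite !mxE !permE.
rewrite row_permE col_permE !det_mulmx !det_perm odd_permV.
by rewrite mulrCA -signr_addb addbb expr0 mulr1.
Qed.

Section Minors.

Variables (A : comNzRingType) (k : nat).

(** Two listings of the same columns differ by a permutation; this frees the
    minors from the increasing order in which they list their columns. *)
Lemma det_colsub_same_image n (f g : 'I_k -> 'I_n) (M : 'M[A]_(k, n)) :
    injective f -> (forall i, f i \in codom g) ->
  exists b : bool, \det (colsub f M) = (-1) ^+ b * \det (colsub g M).
Proof.
move=> inj_f fg; pose h i := iinv (fg i).
have ghE i : g (h i) = f i by apply: f_iinv.
have inj_h : injective h.
  by move=> i j eq_h; apply: inj_f; rewrite -!ghE eq_h.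
exists (perm inj_h : bool).
have -> : colsub f M = col_perm (perm inj_h) (colsub g M).
  by apply/matrixP=> i j; rewrite !mxE permE ghE.
by rewrite col_permE det_mulmx det_perm odd_permV mulrC.
Qed.

Lemma col_minorE n (M : 'M[A]_(k, n)) (g : 'I_k -> 'I_n) (I : {set 'I_n}) :
    injective g -> I =i codom g ->
  exists b : bool, col_minor M I = (-1) ^+ b * \det (colsub g M).
Proof.
move=> inj_g Ig; rewrite /col_minor; case: eqP => [e | []].
  apply: det_colsub_same_image => [i j /enum_val_inj/cast_ord_inj // | i].
  by rewrite -Ig enum_valP.
by rewrite (eq_card Ig) card_codom // card_ord.
Qed.

Lemma row_minor_tr n (M : 'M[A]_(k, n)) (I : {set 'I_n}) :
  row_minor M^T I = col_minor M I.
Proof.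
rewrite /row_minor /col_minor; case: eqP => // e.
by rewrite -[RHS]det_tr trmx_mxsub.
Qed.

(** The sets that contain exactly one of i and k + i for each i, indexed by the
    set J of those i for which k + i is taken. *)
Definition transversal (J : {set 'I_k}) : {set 'I_(k + k)} :=
  [set x | match split x with inl i => i \notin J | inr i => i \in J end].

Lemma lshift_transversal J i : (lshift k i \in transversal J) = (i \notin J).
Proof. by rewrite inE (unsplitK (inl i)). Qed.

Lemma rshift_transversal J i : (rshift k i \in transversal J) = (i \in J).
Proof. by rewrite inE (unsplitK (inr i)). Qed.

Definition in_transversal := (lshift_transversal, rshift_transversal).

Lemma missing_transversal J : missing (transversal J) = J.
Proof. by apply/setP=> i; rewrite inE in_transversal negbK. Qed.

(** Listing the columns of a transversal by pairs, rather than in increasing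
    order, puts the unit columns outside J on the diagonal. *)
Definition transversal_fun (J : {set 'I_k}) (i : 'I_k) : 'I_(k + k) :=
  if i \in J then rshift k i else lshift k i.

Lemma transversal_fun_inj J : injective (transversal_fun J).
Proof.
move=> i j /eqP; rewrite /transversal_fun.
by do 2!case: ifP => _; rewrite ?eq_rshift ?eq_lshift ?eq_rlshift ?eq_lrshift //
  => /eqP.
Qed.

Lemma codom_transversal_fun J : transversal J =i codom (transversal_fun J).
Proof.
move=> x; apply/idP/codomP => [|[i ->]]; last first.
  by rewrite /transversal_fun; case: ifP; rewrite in_transversal => ->.
rewrite -[x]splitK; case: (split x) => i /=; rewrite in_transversal => Ji;
  by exists i; rewrite /transversal_fun ?Ji ?(negPf Ji).
Qed.

Lemma card_transversal J : #|transversal J| = k.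
Proof.
by rewrite (eq_card (codom_transversal_fun J)) card_codom ?card_ord //;
  apply: transversal_fun_inj.
Qed.

(** Bringing the indices of J to the front makes the matrix block triangular,
    with diagonal blocks the submatrix of M at J and an identity matrix. *)
Lemma det_colsub_transversal (M : 'M[A]_k) (J : {set 'I_k}) :
  \det (colsub (transversal_fun J) (row_mx 1%:M M)) = principal_minor M J.
Proof.
(* f lists J first, then its complement. *)
pose f (x : 'I_(#|J| + #|~: J|)) : 'I_k :=
  match split x with inl i => enum_val i | inr i => enum_val i end.
have fl i : f (lshift _ i) = enum_val i by rewrite /f (unsplitK (inl i)).
have fr i : f (rshift _ i) = enum_val i by rewrite /f (unsplitK (inr i)).
have inJ (i : 'I_#|J|) : enum_val i \in J by apply: enum_valP.
have ninJ (i : 'I_#|~: J|) : enum_val i \in J = false.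
  by apply/negbTE; rewrite -in_setC enum_valP.
have inj_f : injective f.
  move=> x y; rewrite -[x]splitK -[y]splitK.
  case: (split x) => i; case: (split y) => j; rewrite /= !(fl, fr).
  - by move/enum_val_inj->.
  - by move=> e; have := ninJ j; rewrite -e inJ.
  - by move=> e; have := ninJ i; rewrite e inJ.
  - by move/enum_val_inj->.
have bij_f : bijective f.
  by apply: inj_card_bij => //; rewrite !card_ord cardsC card_ord.
rewrite -(det_mxsub_bij _ bij_f).
set B := mxsub f f _.
have -> : B = block_mx
    (mxsub (fun i : 'I_#|J| => enum_val i) (fun i : 'I_#|J| => enum_val i) M) 0
    (mxsub (fun i : 'I_#|~: J| => enum_val i)
           (fun i : 'I_#|J| => enum_val i) M) 1%:M.
  apply/matrixP=> x y; rewrite -[x]splitK -[y]splitK.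
  case: (split x) => i; case: (split y) => j;
    rewrite /= ?(block_mxEul, block_mxEur, block_mxEdl, block_mxEdr);
    rewrite 2![LHS]mxE !(fl, fr) /transversal_fun ?inJ ?ninJ;
    rewrite ?(row_mxEl, row_mxEr) !mxE //.
    by case: (enum_val i =P enum_val j) => // e; have := ninJ j; rewrite -e inJ.
  by rewrite (inj_eq enum_val_inj).
by rewrite det_lblock det1 mulr1.
Qed.

Lemma col_minor_transversal (M : 'M[A]_k) (J : {set 'I_k}) :
  exists b : bool,
    col_minor (row_mx 1%:M M) (transversal J) = (-1) ^+ b * principal_minor M J.
Proof.
have [b ->] := col_minorE (row_mx 1%:M M) (@transversal_fun_inj J)
                 (codom_transversal_fun J).
by exists b; rewrite det_colsub_transversal.
Qed.

Lemma principal_minor1 (J : {set 'I_k}) : principal_minor (1%:M : 'M[A]_k) J = 1.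
Proof.
rewrite /principal_minor; set B := mxsub _ _ _.
suff -> : B = 1%:M by rewrite det1.
by apply/matrixP=> i j; rewrite !mxE (inj_eq enum_val_inj).
Qed.

(** A set that contains both i and k + i selects two equal columns of (1 | 1);
    one that contains neither selects columns that all vanish in row i. *)
Lemma bases_L0 (I : {set 'I_(k + k)}) :
  I \in bases (L0 A k) -> I = transversal (missing I).
Proof.
rewrite inE => /andP[_]; rewrite /col_minor; case: eqP => [e | _]; last first.
  by rewrite eqxx.
set f := (X in colsub X) => det_neq0.
have f_onto x : x \in I -> exists j, f j = x.
  move=> Ix; exists (cast_ord e (enum_rank_in Ix x)).
  by rewrite /f cast_ordK enum_rankK_in.
apply/setP=> x; rewrite -[x]splitK; case: (split x) => i /=;
  rewrite in_transversal inE ?negbK //.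
apply/idP/idP => [Ir | nIl].
  apply: contra det_neq0 => Il.
  have [[j1 fj1] [j2 fj2]] := (f_onto _ Il, f_onto _ Ir).
  have ne_j : j1 != j2.
    by apply/eqP=> ej; move: fj1; rewrite ej fj2 => /eqP; rewrite eq_rlshift.
  rewrite -det_tr; apply/eqP/(determinant_alternate ne_j) => l.
  by rewrite 2![LHS]mxE 2![RHS]mxE fj1 fj2 row_mxEl row_mxEr.
apply: contraR det_neq0 => nIr.
rewrite (expand_det_row _ i) big1 // => j _; rewrite mxE /L0.
have : f j \in I by apply: enum_valP.
rewrite -[f j]splitK; case: (split (f j)) => l /= Il;
  rewrite ?(row_mxEl, row_mxEr) mxE; case: eqP => [ei | _]; rewrite ?mul0r //.
  by rewrite ei Il in nIl.
by rewrite ei Il in nIr.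
Qed.

Lemma col_minor_L0 (J : {set 'I_k}) :
  exists b : bool, col_minor (L0 A k) (transversal J) = (-1) ^+ b.
Proof.
have [b ->] := col_minor_transversal 1%:M J.
by exists b; rewrite principal_minor1 mulr1.
Qed.

Lemma transversal_base (J : {set 'I_k}) : transversal J \in bases (L0 A k).
Proof.
rewrite inE card_transversal eqxx /=; have [b ->] := col_minor_L0 J.
by rewrite signr_eq0.
Qed.

Lemma row_minor_R0 (t : A) (S : 'M[A]_k) (J : {set 'I_k}) :
  exists b : bool, row_minor (R0 t S) (transversal J) =
    (-1) ^+ b * principal_minor (r0 t S) J.
Proof. by rewrite row_minor_tr; apply: col_minor_transversal. Qed.

Lemma exch1_transversal (J : {set 'I_k}) p : p \notin J ->
  exch1 (transversal J) (lshift k p) (rshift k p) = transversal (p |: J).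
Proof.
move=> Jp; apply/setP=> x; rewrite -[x]splitK; case: (split x) => i /=;
  rewrite !(in_setU, in_setD, in_set1, in_transversal);
  rewrite !(eq_lshift, eq_rshift, eq_lrshift, eq_rlshift) /= ?orbF.
  by rewrite !negb_or.
by rewrite orbC.
Qed.

Lemma exch2_transversal (J : {set 'I_k}) p q : p \notin J -> q \notin J ->
  exch2 (transversal J) (lshift k p) (lshift k q) (rshift k p) (rshift k q) =
    transversal ([set p; q] :|: J).
Proof.
move=> Jp Jq; apply/setP=> x; rewrite -[x]splitK; case: (split x) => i /=;
  rewrite !(in_setU, in_setD, in_set1, in_transversal);
  rewrite !(eq_lshift, eq_rshift, eq_lrshift, eq_rlshift) /= ?orbF.
  by rewrite !negb_or.
by rewrite orbC.
Qed.

End Minors.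

(** * Principal minors of r_0(tau) *)

Lemma r0E (A : comNzRingType) k (t : A) (S : 'M[A]_k) :
  r0 t S = S + t *: const_mx 1.
Proof.
rewrite /r0 addrC; congr (_ + _ *: _).
by apply/matrixP=> i j; rewrite !mxE big_ord1 !mxE mulr1.
Qed.

Lemma principal_minor_r0 (F : idomainType) k (t : F) (S : 'M[F]_k)
    (J : {set 'I_k}) :
    (2%:R : F) != 0 -> S^T = - S ->
  principal_minor (r0 t S) J = principal_minor (r0 1 S) J * t ^+ odd #|J|.
Proof.
move=> two_neq0 skewS; rewrite /principal_minor !r0E.
set f := fun i : 'I_#|J| => enum_val i.
have subE s : mxsub f f (S + s *: const_mx 1) =
    mxsub f f S + s *: const_mx 1.
  by apply/matrixP=> i j; rewrite !mxE.
rewrite !subE scale1r det_skew_all_ones // trmx_mxsub skewS.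
by apply/matrixP=> i j; rewrite !mxE.
Qed.

Lemma map_principal_minor (A B : comNzRingType) (f : {rmorphism A -> B}) k
    (M : 'M[A]_k) (J : {set 'I_k}) :
  principal_minor (map_mx f M) J = f (principal_minor M J).
Proof. by rewrite /principal_minor -det_map_mx map_mxsub. Qed.

Lemma map_r0 (A B : comNzRingType) (f : {rmorphism A -> B}) k (t : A)
    (S : 'M[A]_k) : map_mx f (r0 t S) = r0 (f t) (map_mx f S).
Proof. by rewrite !r0E map_mxD map_mxZ map_const_mx rmorph1. Qed.

(** * The genericity condition *)

(** The skew-symmetric matrix that witnesses that the generic set is non-empty:
    adding the all-ones matrix clears everything below its diagonal. *)
Definition sign_matrix (A : pzRingType) k : 'M[A]_k :=
  \matrix_(i, j) ((i < j)%N%:R - (j < i)%N%:R).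

(** Triangularity survives in principal submatrices because sets of ordinals
    are enumerated in increasing order. *)
Lemma enum_val_ltn k (J : {set 'I_k}) (i j : 'I_#|J|) :
  (i < j)%N -> (enum_val i < enum_val j)%N.
Proof.
move=> lt_ij; have x0 := enum_val i.
rewrite !(enum_val_nth x0).
have srt : sorted ltn (map val (enum J)).
  rewrite sorted_map {1}/enum_mem -enumT sorted_filter //.
    by move=> ? ? ?; apply: ltn_trans.
  by rewrite -sorted_map val_enum_ord iota_ltn_sorted.
rewrite -!(nth_map _ 0%N val) -?cardE ?ltn_ord //.
by apply: (sorted_ltn_nth ltn_trans); rewrite ?inE ?size_map -?cardE.
Qed.

Lemma sign_matrix_minor (A : comNzRingType) k (J : {set 'I_k}) :
  principal_minor (r0 1 (sign_matrix A k)) J = 1.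
Proof.
rewrite /principal_minor -det_tr det_trig => [|]; last first.
  apply/is_trig_mxP => i j lt_ij; rewrite r0E !mxE.
  rewrite (enum_val_ltn lt_ij) ltnNge ltnW ?enum_val_ltn //=.
  by rewrite sub0r mulr1 addNr.
by rewrite big1 // => i _; rewrite r0E !mxE ltnn subrr add0r mulr1.
Qed.

Section Generic.

Variables (C : fieldType) (k : nat).

Definition nondegenerate (S : 'M[C]_k) : Prop :=
  forall J : {set 'I_k}, principal_minor (r0 1 S) J != 0.

(** A single polynomial cuts out the generic set: the product of the principal
    minors of r_0(1) for a matrix of indeterminates. *)
Definition nondegenerate_poly : {mpoly C[k * k]} :=
  \prod_(J : {set 'I_k}) principal_minor
    (r0 1 (\matrix_(i, j) 'X_(mxvec_index i j))) J.

Lemma nondegenerate_polyP (S : 'M[C]_k) :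
  nondegenerate_poly.@[fun i => mxvec S 0 i] != 0 <-> nondegenerate S.
Proof.
rewrite /nondegenerate_poly rmorph_prod /=.
under eq_bigr => J _.
  rewrite -map_principal_minor map_r0 rmorph1.
  have -> : map_mx (meval (fun i => mxvec S 0 i))
      (\matrix_(i, j) 'X_(mxvec_index i j)) = S.
    by apply/matrixP=> i j; rewrite !mxE mevalXU mxvecE.
  over.
split=> [/prodf_neq0 nz J | nz]; first exact: nz.
by apply/prodf_neq0 => J _; apply: nz.
Qed.

Lemma generic_skew (Q : 'M[C]_k -> Prop) :
    (forall S, skew_symmetric S -> nondegenerate S -> Q S) ->
  for_generic_skew Q.
Proof.
move=> QS; exists (fun S => skew_symmetric S /\ nondegenerate S); split.
- exists (fun p => p = nondegenerate_poly) => S.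
  split=> -[skewS nzS]; split=> //.
    by exists nondegenerate_poly => //; apply/nondegenerate_polyP.
  by case: nzS => _ -> /nondegenerate_polyP.
- exists (sign_matrix C k); split.
    by apply/matrixP=> i j; rewrite !mxE opprB.
  by move=> J; rewrite sign_matrix_minor oner_neq0.
- by move=> S [skewS nzS]; apply: QS.
Qed.

End Generic.

(** * Constants among the rational functions *)

HB.instance Definition _ (C : fieldType) (d : nat) :=
  GRing.RMorphism.copy (@ratC C d) (@tofrac {mpoly C[d]} \o @mpolyC d C).

Lemma ratC_neq0 (C : fieldType) d (c : C) : c != 0 -> ratC d c != 0.
Proof. by rewrite fmorph_eq0. Qed.

Section Constants.

Variables (C : fieldType) (d : nat).

Lemma is_constantMl (c : C) (x : ratfun C d) :
  c != 0 -> is_constant (ratC d c * x) -> is_constant x.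
Proof.
move=> nz_c [a xE]; exists (c^-1 * a).
by rewrite rmorphM fmorphV /= -xE mulKf // fmorph_eq0.
Qed.

Lemma same_exponent_constant e (x y : ratfun C d) :
    monomial_with_exponent e x -> monomial_with_exponent e y ->
  is_constant x -> is_constant y.
Proof.
rewrite /monomial_with_exponent; move: (\prod_(u < d) _) => mono.
move=> [a nz_a ->] [b nz_b ->] [c cE].
exists (b / a * c); rewrite rmorphM /= -cE mulrA -rmorphM /=.
by rewrite mulfVK.
Qed.

End Constants.

Lemma is_constant_sqr (C : numClosedFieldType) d (x : ratfun C d) :
  is_constant (x ^+ 2) -> is_constant x.
Proof.
move=> [c xE]; have /eqP : x ^+ 2 = ratC d (sqrtC c) ^+ 2.
  by rewrite -rmorphXn /= sqrtCK.
rewrite eqf_sqr => /orP[]/eqP->; first by exists (sqrtC c).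
by exists (- sqrtC c); rewrite rmorphN.
Qed.

(** * Separability *)

Section Chi.

(* These facts are proved over an abstract ring: deciding membership by
   computation in a field of fractions would unfold its construction. *)
Variables (F : comNzRingType) (n : nat) (h : {set 'I_n} -> F).
Variables (I : {set 'I_n}) (i j a b : 'I_n).

Lemma chi_double_exchange : h I * h (exch2 I i j a b) \in chi h I i j a b.
Proof. by rewrite !inE eqxx. Qed.

Lemma chi_single_exchanges :
  h (exch1 I i a) * h (exch1 I j b) \in chi h I i j a b.
Proof. by rewrite !inE eqxx orbT. Qed.

Lemma observable_mem (X : {fset F}) x : x \in X -> x != 0 -> observable X.
Proof. by move=> Xx; apply: contraNneq => X0; rewrite X0 inE in Xx. Qed.

End Chi.

Section Configuration.

Variables (C : numClosedFieldType) (d k : nat) (S : 'M[C]_k).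
Hypotheses (skewS : skew_symmetric S) (nzS : nondegenerate S).
Variable tau : ratfun C d.
Hypothesis tau_nonconstant : ~ is_constant tau.

Let Rm := R0 tau (const_matrix d S).

(** Up to a non-zero constant the minor at J depends only on the parity of |J|;
    the constant is the value at tau = 1, which nondegeneracy keeps from
    vanishing. *)
Lemma row_minor_monomial (J : {set 'I_k}) :
  exists2 c : C, c != 0 &
    row_minor Rm (transversal J) = ratC d c * tau ^+ odd #|J|.
Proof.
have [b ->] := row_minor_R0 tau (const_matrix d S) J.
exists ((-1) ^+ b * principal_minor (r0 1 S) J).
  by rewrite mulf_neq0 ?signr_eq0.
rewrite principal_minor_r0.
- rewrite -[X in r0 X](rmorph1 (@ratC C d)) -map_r0 map_principal_minor.
  by rewrite rmorphM rmorph_sign mulrA.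
- by rewrite -(rmorph_nat (@ratC C d)) fmorph_eq0 pnatr_eq0.
- by rewrite map_trmx skewS map_mxN.
Qed.

Lemma row_minor_constant (I : {set 'I_(k + k)}) : I \in bases (L0 C k) ->
  is_constant (row_minor Rm I) <-> ~~ odd #|missing I|.
Proof.
move/bases_L0=> ->; rewrite missing_transversal.
have [c nz_c ->] := row_minor_monomial (missing I).
case: (odd _); split=> //; last by exists c; rewrite mulr1.
by rewrite expr1 => /(is_constantMl nz_c)/tau_nonconstant.
Qed.

Lemma hterm_monomial (J : {set 'I_k}) :
  exists2 c : C, c != 0 &
    hterm (L0 C k) Rm (transversal J) = ratC d c * tau ^+ odd #|J|.
Proof.
have [c nz_c rE] := row_minor_monomial J; have [b lE] := col_minor_L0 C J.
exists ((-1) ^+ b * c); first by rewrite mulf_neq0 ?signr_eq0.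
by rewrite /hterm lE rE rmorphM mulrA.
Qed.

(** Exchanging p and q together keeps the parity of |J|, while exchanging either
    one alone changes it, so the first two elements of the observable set are a
    constant and a multiple of tau^2. *)
Lemma transversal0_not_separable (p q : 'I_k) : p != q ->
  ~ separable_basis (L0 C k) Rm (transversal set0).
Proof.
move=> ne_pq sep.
have nz_tau : tau != 0.
  by apply/eqP=> t0; apply: tau_nonconstant; exists 0; rewrite rmorph0.
have lshiftI i : lshift k i \in transversal set0 by rewrite in_transversal inE.
have rshiftI i : rshift k i \in ~: transversal set0.
  by rewrite inE in_transversal inE.
have := sep _ _ _ _ (lshiftI p) (lshiftI q) _ (rshiftI p) (rshiftI q).
rewrite eq_lshift eq_rshift => /(_ ne_pq ne_pq).
have := chi_single_exchanges (hterm (L0 C k) Rm) (transversal set0)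
  (lshift k p) (lshift k q) (rshift k p) (rshift k q).
have := chi_double_exchange (hterm (L0 C k) Rm) (transversal set0)
  (lshift k p) (lshift k q) (rshift k p) (rshift k q).
move: (chi _ _ _ _ _ _) => X.
have notin0 (i : 'I_k) : i \notin set0 by rewrite inE.
rewrite (exch2_transversal (notin0 p) (notin0 q)).
rewrite (exch1_transversal (notin0 p)) (exch1_transversal (notin0 q)) !setU0.
have [c0 nz0 ->] := hterm_monomial set0.
have [c2 nz2 ->] := hterm_monomial [set p; q].
have [cp nzp ->] := hterm_monomial [set p].
have [cq nzq ->] := hterm_monomial [set q].
rewrite cards0 cards2 ne_pq !cards1 !expr0 !mulr1 expr1.
set x := ratC d c0 * _; set y := ratC d cp * tau * _ => Xx Xy.
have nzx : x != 0 := mulf_neq0 (ratC_neq0 d nz0) (ratC_neq0 d nz2).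
have nzy : y != 0 :=
  mulf_neq0 (mulf_neq0 (ratC_neq0 d nzp) nz_tau)
            (mulf_neq0 (ratC_neq0 d nzq) nz_tau).
case/(_ (observable_mem Xx nzx)) => e mono.
have [c yE] : is_constant y.
  apply: (same_exponent_constant (mono _ Xx nzx) (mono _ Xy nzy)).
  by exists (c0 * c2); rewrite rmorphM.
apply: tau_nonconstant; apply: is_constant_sqr.
apply: (@is_constantMl _ _ (cp * cq)); first by rewrite mulf_neq0.
by exists c; rewrite -yE rmorphM expr2 mulrACA.
Qed.

End Configuration.

Theorem proposition32 (R : realType) (d k : nat) (hk : (5 <= k)%N) :
  for_generic_skew (fun S : 'M[complex R]_k =>
    forall tau : ratfun (complex R) d,
      is_monomial tau -> ~ is_constant tau ->
      let L := L0 (complex R) k in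
      let r := r0 tau (const_matrix d S) in
      let Rm := R0 tau (const_matrix d S) in
      [/\ forall I : {set 'I_(k + k)}, I \in bases L ->
            (is_constant (row_minor Rm I) <-> ~~ odd #|missing I|),
          forall I : {set 'I_(k + k)}, I \in bases L ->
            row_minor Rm I = principal_minor r (missing I) \/
            row_minor Rm I = - principal_minor r (missing I)
        & exists2 I : {set 'I_(k + k)}, I \in bases L
            & ~ separable_basis L Rm I]).
Proof.
apply: generic_skew => S skewS nzS tau _ tau_nonconstant L r Rm; split.
- by move=> I; apply: row_minor_constant.
- move=> I /bases_L0->; rewrite missing_transversal.
  have [[] ->] := row_minor_R0 tau (const_matrix d S) (missing I).
    by right; rewrite mulN1r.
  by left; rewrite mul1r.
- exists (transversal set0); first exact: transversal_base.
  have k_gt0 : (0 < k)%N by apply: leq_trans hk.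
  have k_gt1 : (1 < k)%N by apply: leq_trans hk.
  exact: (@transversal0_not_separable _ _ _ _ skewS nzS _ tau_nonconstant
            (Ordinal k_gt0) (Ordinal k_gt1)).
Qed.
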